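(* Let $a\in\mathbb{R}$, let $0<\eta<1$, and let $q_1(x,\eta)$ be a weight function that is continuous in $x$ and satisfies $\lim_{\eta\to 1}q_1(x,\eta)=1$. Take $q_2(x,\eta)=(x-a)^{\eta-1}$. Then the $\overline{q}$-weighted fractional Riemann--Liouville derivative of order $\eta$ of a constant is zero: for every constant function $h\equiv c$ and every $x>a$, $$\left({}^{\overline{q}}D_{a^+}^{\eta}\,c\right)(x)=0 ;$$ in particular $\left({}^{\overline{q}}D_{a^+}^{\eta}\,1\right)(x)=0$.
   Context: For $\mu>0$, the Riemann--Liouville fractional integral of order $\mu$ based at $a$ is $$\left(I_{a^+}^{\mu}h\right)(x)=\frac{1}{\Gamma(\mu)}\int_a^x\frac{h(t)}{(x-t)^{1-\mu}}\,dt,\qquad x>a.$$ For $0<\eta<1$ and a pair of weights $\overline{q}=(q_1,q_2)$, with $q_1(x,\eta)$ continuous and $q_2(x,\eta)$ continuously differentiable in $x$ and with $\lim_{\eta\to1}q_1(x,\eta)=\lim_{\eta\to1}q_2(x,\eta)=1$, the $\overline{q}$-weighted fractional Riemann--Liouville derivative of order $\eta$ is $$\left({}^{\overline{q}}D_{a^+}^{\eta}h\right)(x)=q_1(x,\eta)\,\frac{d}{dx}\Big[q_2(x,\eta)\left(I_{a^+}^{1-\eta}h\right)(x)\Big],\qquad x>a.$$ With $q_2(x,\eta)=(x-a)^{\eta-1}$ this reads $$\left({}^{\overline{q}}D_{a^+}^{\eta}h\right)(x)=q_1(x,\eta)\,\frac{d}{dx}\Big[(x-a)^{\eta-1}\left(I_{a^+}^{1-\eta}h\right)(x)\Big].$$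 *)

(* Defs.v *)
From HB Require Import structures.
From mathcomp Require Import all_boot all_order all_algebra.
From mathcomp Require Import all_classical all_reals all_analysis.

Set Implicit Arguments.
Unset Strict Implicit.
Unset Printing Implicit Defensive.

Import Order.TTheory GRing.Theory Num.Theory.
Import numFieldNormedType.Exports.

Local Open Scope classical_set_scope.
Local Open Scope ring_scope.

Section RiemannLiouville.
Context {R : realType}.

Local Notation leb := (@lebesgue_measure R).

(* Euler's integral; meaningful for 0 < s (Rintegral is total). *)
Definition Gamma (s : R) : R :=
  \int[leb]_(t in `]0, +oo[%classic) (t `^ (s - 1) * expR (- t)).

Definition RLkernel (mu : R) (h : R -> R) (x t : R) : R :=
  h t / (x - t) `^ (1 - mu).

(* The integral is singular at t = x when mu < 1; it is read as a Lebesgue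
   integral, so the singularity needs no separate limit.  It is only meaningful
   where [RLintegrable] holds. *)
Definition RLintegral (a mu : R) (h : R -> R) (x : R) : R :=
  (Gamma mu)^-1 * \int[leb]_(t in `]a, x[%classic) RLkernel mu h x t.

Definition RLintegrable (a mu : R) (h : R -> R) (x : R) : Prop :=
  leb.-integrable `]a, x[%classic (EFin \o RLkernel mu h x).

(* Both weights are functions of the point x and of the order eta. *)
Definition wRLderive (q1 q2 : R -> R -> R) (a eta : R) (h : R -> R) (x : R)
  : R :=
  q1 x eta * (fun y => q2 y eta * RLintegral a (1 - eta) h y)^`()%classic x.

(* [derive1] and [Rintegral] are total, so the existence of the weighted
   derivative has to be expressed separately. *)
Definition wRLderivable (q2 : R -> R -> R) (a eta : R) (h : R -> R) (x : R)
  : Prop :=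
  (\forall y \near x, RLintegrable a (1 - eta) h y) /\
  derivable (fun y => q2 y eta * RLintegral a (1 - eta) h y) x 1.

Definition power_weight (a x eta : R) : R := (x - a) `^ (eta - 1).

End RiemannLiouville.

(* Main.v *)
Require Import Defs.
From mathcomp Require Import all_boot all_order all_algebra.
From mathcomp Require Import all_classical all_reals all_analysis.
From mathcomp Require Import measurable_realfun.

Import Order.TTheory GRing.Theory Num.Theory.
Import numFieldNormedType.Exports.

Local Open Scope classical_set_scope.
Local Open Scope ring_scope.

(** The integral of [(x - t) ^ (mu - 1)] over [`]a, x[] is [(x - a) ^ mu / mu]: the
    antiderivative [- (x - t) ^ mu / mu] extends continuously by [0] to the
    singular endpoint [t = x].  Hence for [mu = 1 - eta] the fractional integral
    of a constant is proportional to [(x - a) ^ (1 - eta)], and the weight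
    [(x - a) ^ (eta - 1)] turns it into a constant near every [x > a]. *)

(** The compact intervals from [a] to [s n = b - 1/(n+1)] exhaust the domain. The usual fundamental
    theorem applies on each, and monotone convergence, available because [f] is nonnegative, passes
    to the limit even if [f] blows up at [b]. *)
Lemma ge0_FTC2_at_left (R : realType) (f F : R -> R) (a b l : R) : a < b ->
  (forall x, a <= x < b -> 0 <= f x) ->
  (forall x, a <= x < b -> {for x, continuous f}) ->
  (forall x, a <= x < b -> is_derive x 1 F (f x)) ->
  F x @[x --> b^'-] --> l ->
  (\int[lebesgue_measure]_(x in `[a, b[) (f x)%:E = (l - F a)%:E)%E.
Proof.
move=> ab f0 cf dF Fl; pose s n : R := b - n.+1%:R^-1.
have sb n : s n < b by rewrite ltrBlDr ltrDl invr_gt0.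
have cfs n : {within `[a, s n], continuous f}.
  apply: continuous_in_subspaceT => x; rewrite inE/= in_itv/= => /andP[ax xs].
  by apply: cf; rewrite ax (le_lt_trans xs).
have scvg : s n @[n --> \oo] --> b.
  by rewrite -[X in _ --> X]subr0; apply: cvgB; [exact: cvg_cst|exact: cvg_harmonic].
have Fs : (F (s n) - F a)%:E @[n --> \oo] --> (l - F a)%:E.
  apply: cvg_EFin; first exact: nearW.
  apply: cvgB; last exact: cvg_cst.
  by move/cvg_at_leftP : Fl; apply; split.
suff Is : (\int[lebesgue_measure]_(x in `[a, s n]) (f x)%:E @[n --> \oo]
    --> \int[lebesgue_measure]_(x in `[a, b[) (f x)%:E)%E.
  apply/esym/(cvg_unique _ Fs); first exact: ereal_hausdorff.
  (* For small [n] the point [s n] may lie left of [a], so the two sequences are compared only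
     eventually. *)
  apply: cvg_trans Is; apply: near_eq_cvg; near=> n.
  have an : a < s n by near: n; exact: (cvgr_gt b).
  rewrite EFinB; apply: continuous_FTC2 => //.
  - have dFs x : a <= x -> x <= s n -> is_derive x 1 F (f x).
      by move=> ax xs; apply: dF; rewrite ax (le_lt_trans xs).
    have /(continuous_within_itvP _ an)[_ Fa Fsn] :
        {within `[a, s n], continuous F}.
      apply: derivable_within_continuous => x.
      by rewrite in_itv/= => /andP[ax xs]; case: (dFs x ax xs).
    split=> // x; rewrite in_itv/= => /andP[/ltW ax /ltW xs].
    by case: (dFs x ax xs).
  - move=> x; rewrite in_itv/= => /andP[/ltW ax xs].
    rewrite derive1E; apply: derive_val; apply: dF.
    by rewrite ax (lt_trans xs).
rewrite itv_bnd_open_bigcup; apply: ge0_nondecreasing_set_cvg_integral => //.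
- move=> m n mn; rewrite subsetEset; apply: subset_itvl; rewrite bnd_simp.
  by rewrite lerB// lef_pV2 ?posrE// ler_nat.
- move=> n; apply/measurable_EFinP.
  exact: subspace_continuous_measurable_fun.
- move=> n x; rewrite /= in_itv/= => /andP[ax xs]; rewrite lee_fin f0//.
  by rewrite ax (le_lt_trans xs).
Unshelve. all: by end_near. Qed.

Lemma RLkernel1E (R : realType) (mu x : R) :
  RLkernel mu (cst 1) x = fun t => (x - t) `^ (mu - 1).
Proof. by apply/funext => t; rewrite /RLkernel/= mul1r -powRN opprB. Qed.

Lemma integral_RLkernel1 (R : realType) (a mu x : R) : 0 < mu -> a < x ->
  (\int[lebesgue_measure]_(t in `]a, x[) (RLkernel mu (cst 1) x t)%:E
   = ((x - a) `^ mu / mu)%:E)%E.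
Proof.
move=> mu0 ax.
(* Used with two exponents: [r = mu - 1] for continuity of the kernel, [r = mu] for its
   antiderivative. *)
have dp r t : t < x ->
    is_derive t (1 : R) (fun u => (x - u) `^ r) (r * (x - t) `^ (r - 1) * -1).
  move=> tx; have xt0 : 0 < x - t by rewrite subr_gt0.
  apply: (@is_derive1_comp _ (fun v => v `^ r) (fun u => x - u)).
    exact: is_derive1_powR.
  by rewrite -[X in is_derive _ _ _ X]sub0r; exact: is_deriveB.
have cK t : a <= t < x -> {for t, continuous (RLkernel mu (cst 1) x)}.
  move=> /andP[_ tx].
  apply: differentiable_continuous; apply/derivable1_diffP.
  by rewrite RLkernel1E; case: (dp (mu - 1) t tx).
have dF t : a <= t < x -> is_derive t (1 : R)
    (fun u => - mu^-1 * (x - u) `^ mu) (RLkernel mu (cst 1) x t).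
  move=> /andP[_ /(dp mu) {}dp].
  rewrite RLkernel1E (_ : _ `^ _ = - mu^-1 *: (mu * (x - t) `^ (mu - 1) * -1)).
    exact: is_deriveZ.
  by rewrite /GRing.scale/= mulrN1 mulrNN mulKf ?gt_eqF.
(* Adding the null point [a] gives the half-open interval of [ge0_FTC2_at_left]. *)
rewrite -(@integral_itv_bndoo _ _ _ (EFin \o RLkernel mu (cst 1) x) true true);
  last first.
  apply/measurable_EFinP; apply: open_continuous_measurable_fun => // t.
  rewrite inE/= in_itv/= => /andP[/ltW at_ tx].
  by apply: cK; rewrite at_ tx.
rewrite (@ge0_FTC2_at_left _ _ (fun u => - mu^-1 * (x - u) `^ mu) _ _ 0)//.
- by rewrite sub0r mulNr opprK mulrC.
- by move=> t _; rewrite RLkernel1E powR_ge0.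
(* As [u] tends to [x] from the left, [x - u] tends to 0 from the right, where [mu > 0] makes the
   power vanish. *)
- rewrite -[X in _ --> X](mulr0 (- mu^-1)); apply: cvgMr.
  apply/cvg_at_leftP => u [ux uc].
  have /cvg_at_rightP := powR_cvg0 mu0; apply; split.
    by move=> n; rewrite subr_gt0.
  by rewrite -(subrr x); apply: cvgB => //; exact: cvg_cst.
Qed.

Lemma RLkernel_cst (R : realType) (mu c x : R) :
  RLkernel mu (cst c) x = fun t => c * RLkernel mu (cst 1) x t.
Proof. by apply/funext => t; rewrite /RLkernel/= mul1r. Qed.

(** Once [c] is factored out, the kernel is nonnegative, so its absolute integral is the finite
    value from [integral_RLkernel1]. *)
Lemma RLintegrable_cst (R : realType) (a mu c x : R) : 0 < mu -> a < x ->
  RLintegrable a mu (cst c) x.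
Proof.
move=> mu0 ax; rewrite /RLintegrable RLkernel_cst.
pose K := EFin \o RLkernel mu (cst 1) x.
rewrite (_ : EFin \o _ = fun t => (c%:E * K t)%E)//.
apply: integrableZl => //.
apply/integrableP; split.
  apply/measurable_EFinP; apply: measurable_funTS.
  rewrite RLkernel1E; apply: (measurableT_comp (measurable_powR _)).
  exact: measurable_funB.
under eq_integral => t _.
  rewrite /= ger0_norm ?mulr_ge0 ?invr_ge0 ?powR_ge0//.
  over.
by rewrite integral_RLkernel1// ltry.
Qed.

Lemma RLintegral_cst (R : realType) (a mu c x : R) : 0 < mu -> a < x ->
  RLintegral a mu (cst c) x = (Gamma mu)^-1 * (c * ((x - a) `^ mu / mu)).
Proof.
move=> mu0 ax; rewrite /RLintegral RLkernel_cst RintegralZl//.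
  by rewrite /Rintegral integral_RLkernel1.
exact: RLintegrable_cst.
Qed.

Theorem mainTheorem1 (R : realType) (a eta : R) (q1 : R -> R -> R)
  (heta : 0 < eta < 1)
  (q1_cont : forall e : R, 0 < e < 1 ->
     forall x : R, a < x -> {for x, continuous (fun y : R => q1 y e)})
  (q1_lim : forall x : R, a < x -> q1 x e @[e --> (1 : R)^'-] --> (1 : R)) :
  (forall c x : R, a < x ->
     wRLderivable (power_weight a) a eta (cst c) x /\
     wRLderive q1 (power_weight a) a eta (cst c) x = 0) /\
  (forall x : R, a < x ->
     wRLderive q1 (power_weight a) a eta (cst 1) x = 0).
Proof.
suff H c x : a < x -> wRLderivable (power_weight a) a eta (cst c) x /\
    wRLderive q1 (power_weight a) a eta (cst c) x = 0.
  by split=> // x /(H 1)[].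
move=> ax; have mu0 : 0 < 1 - eta by case/andP: heta => _; rewrite subr_gt0.
(* What remains of [RLintegral_cst] once the weight cancels [(y - a) ^ (1 - eta)]. *)
pose k := (Gamma (1 - eta))^-1 * (c / (1 - eta)).
have near_cst : \forall y \near x,
    cst k y = power_weight a y eta * RLintegral a (1 - eta) (cst c) y.
  near=> y; have ay : a < y by near: y; exact: lt_nbhsr.
  (* The cancellation needs a nonzero power, hence [y > a]. *)
  have ya0 : (y - a) `^ (1 - eta) != 0 by rewrite gt_eqF ?powR_gt0 ?subr_gt0.
  rewrite RLintegral_cst// /power_weight -[eta - 1]opprB powRN /k /=.
  by rewrite [RHS]mulrCA [c * (_ `^ _ / _)]mulrCA mulKf.
split; first split.
- near=> y; apply: RLintegrable_cst => //.
  by near: y; exact: lt_nbhsr.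
(* Derivability and the derivative at [x] depend only on values near [x], so both are inherited from
   [cst k]. *)
- by apply: near_eq_derivable near_cst _ => //; exact: derivable_cst.
- rewrite /wRLderive derive1E -(near_eq_derive _ near_cst)//.
  by rewrite derive_cst mulr0.
Unshelve. all: by end_near. Qed.
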